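(* Let $(M,h)$ be a closed Riemannian spin surface, let $\lambda,\kappa\in\mathbb{R}$, and let $\psi=(\psi^1,\dots,\psi^q)\in\Gamma(\Sigma M\otimes\mathbb{R}^q)$ be a solution of $$\not\partial\psi^i=\lambda\psi^i+\kappa|\psi|^2\psi^i,\qquad i=1,\dots,q.$$ Then for all $i,m\in\{1,\dots,q\}$ the Noether current $$J^{im}_\alpha:=\langle\psi^i,e_\alpha\cdot\psi^m\rangle_{\Sigma M}$$ is conserved, that is, $\nabla_{e_\alpha}J^{im}_\alpha=0$ (sum over $\alpha$; the divergence of $J^{im}$ vanishes).
   Context: $\Sigma M$ is the spinor bundle of $(M,h)$ with hermitian scalar product $\langle\cdot,\cdot\rangle_{\Sigma M}$ and metric spin connection $\nabla^{\Sigma M}$. Clifford multiplication by tangent vectors is skew-symmetric, $\langle\psi,X\cdot\eta\rangle=-\langle X\cdot\psi,\eta\rangle$, and satisfies $X\cdot Y\cdot\psi+Y\cdot X\cdot\psi=-2h(X,Y)\psi$. $(e_\alpha)$ is a local orthonormal frame of $TM$, $\not\partial=e_\alpha\cdot\nabla^{\Sigma M}_{e_\alpha}$ is the Dirac operator, and $|\psi|^2=\sum_{j=1}^q|\psi^j|^2_{\Sigma M}$. $J^{im}$ is viewed as a complex-valued one-form (vector field) on $M$ with components $J^{im}_\alpha=J^{im}(e_\alpha)$. $\Gamma$ denotes smooth sections. *)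

(* Defs.v *)
From mathcomp Require Import all_boot all_order all_algebra.
From mathcomp Require Import all_classical all_reals all_analysis.
From mathcomp Require Import complex ring.

Set Implicit Arguments.
Unset Strict Implicit.
Unset Printing Implicit Defensive.

Import Order.TTheory GRing.Theory Num.Theory.
Import numFieldNormedType.Exports.

Local Open Scope classical_set_scope.
Local Open Scope ring_scope.

(* iterated partial derivatives; [:: k1; ...; kn] stands for d_k1 ... d_kn *)
Definition pderiv (R : realType) (s : seq 'I_2) (f : 'rV[R]_2 -> R) :
    'rV[R]_2 -> R :=
  foldr (fun k g x => 'D_(delta_mx 0 k) g x) f s.

(* C^infinity; only used when D is open *)
Definition smooth_on (R : realType) (D : set 'rV[R]_2) (f : 'rV[R]_2 -> R) :=
  forall (s : seq 'I_2) (x : 'rV[R]_2), D x ->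
    {for x, continuous (pderiv s f)} /\
    forall k : 'I_2, derivable (pderiv s f) x (delta_mx 0 k).

Definition cderive (R : realType) (f : 'rV[R]_2 -> R[i]) (x v : 'rV[R]_2) :
    R[i] :=
  Complex ('D_v (fun y => complex.Re (f y)) x)
          ('D_v (fun y => complex.Im (f y)) x).

(* A compact Hausdorff space with a smooth atlas of charts onto open subsets of
   R^2 (hence without boundary); [param i] is the inverse of the chart
   [coord i] on its domain. *)
Record closed_surface (R : realType) := ClosedSurface {
  space :> topologicalType ;
  surf_compact : compact [set: space] ;
  surf_hausdorff : hausdorff_space space ;
  cidx : Type ;
  cdom : cidx -> set space ;
  coord : cidx -> space -> 'rV[R]_2 ;
  param : cidx -> 'rV[R]_2 -> space ;
  cdom_open : forall i, open (cdom i) ;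
  cdom_cover : forall p, exists i, cdom i p ;
  cimg_open : forall i, open (coord i @` cdom i) ;
  coordK : forall i p, cdom i p -> param i (coord i p) = p ;
  coord_cont : forall i p, cdom i p -> {for p, continuous (coord i)} ;
  param_cont : forall i x, (coord i @` cdom i) x ->
    {for x, continuous (param i)} ;
  transition_smooth : forall i j (k : 'I_2),
    smooth_on (coord i @` (cdom i `&` cdom j))
              (fun x => coord j (param i x) 0 k)
}.

Definition smooth_fun (R : realType) (M : closed_surface R) (i : cidx M)
    (W : set M) (f : M -> R) :=
  smooth_on (coord i @` (cdom i `&` W)) (fun x => f (param i x)).

Definition smooth_cfun (R : realType) (M : closed_surface R) (i : cidx M)
    (W : set M) (f : M -> R[i]) :=
  smooth_fun i W (fun p => complex.Re (f p)) /\
  smooth_fun i W (fun p => complex.Im (f p)).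

(* entry (k, l) is the k-th partial derivative of the l-th coordinate of
   chart j with respect to chart i *)
Definition jac (R : realType) (M : closed_surface R) (i j : cidx M) (p : M) :
    'M[R]_2 :=
  \matrix_(k, l)
    'D_(delta_mx 0 k) (fun x => coord j (param i x) 0 l) (coord i p).

(* A vector field is given by its components [X i p] with respect to the
   coordinate basis of each chart i; they are meaningful when p is in the
   domain of i. *)
Definition vector_field_on (R : realType) (M : closed_surface R) (W : set M)
    (X : cidx M -> M -> 'rV[R]_2) :=
  (forall i (k : 'I_2), smooth_fun i W (fun p => X i p 0 k)) /\
  (forall i j p, W p -> cdom i p -> cdom j p -> X j p = X i p *m jac i j p).

Record riem_metric (R : realType) (M : closed_surface R) := RiemMetric {
  metric : cidx M -> M -> 'M[R]_2 ;
  metric_smooth : forall i (k l : 'I_2),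
    smooth_fun i setT (fun p => metric i p k l) ;
  metric_sym : forall i p, cdom i p -> (metric i p)^T = metric i p ;
  metric_pos : forall i p (v : 'rV[R]_2), cdom i p -> v != 0 ->
    0 < (v *m metric i p *m v^T) 0 0 ;
  metric_change : forall i j p, cdom i p -> cdom j p ->
    metric i p = jac i j p *m metric j p *m (jac i j p)^T
}.

Definition hdot (R : realType) (M : closed_surface R) (h : riem_metric M)
    (i : cidx M) (p : M) (u v : 'rV[R]_2) : R :=
  (u *m metric h i p *m v^T) 0 0.

Definition dmetric (R : realType) (M : closed_surface R) (h : riem_metric M)
    (i : cidx M) (p : M) (l m n : 'I_2) : R :=
  'D_(delta_mx 0 l) (fun x => metric h i (param i x) m n) (coord i p).

(* Christoffel symbol with upper index k and lower indices l, m *)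
Definition christoffel (R : realType) (M : closed_surface R)
    (h : riem_metric M) (i : cidx M) (p : M) (k l m : 'I_2) : R :=
  2^-1 * \sum_(n < 2) invmx (metric h i p) k n *
    (dmetric h i p l m n + dmetric h i p m l n - dmetric h i p n l m).

(* covariant derivative at p of the vector field Y along the vector v *)
Definition levi_civita (R : realType) (M : closed_surface R)
    (h : riem_metric M) (i : cidx M) (p : M) (v : 'rV[R]_2)
    (Y : cidx M -> M -> 'rV[R]_2) : 'rV[R]_2 :=
  \row_(k < 2) ('D_v (fun x => Y i (param i x) 0 k) (coord i p) +
    \sum_(l < 2) \sum_(m < 2) christoffel h i p k l m * v 0 l * Y i p 0 m).

(* gam 0 = [0, 1; -1, 0] and gam 1 = [0, i; i, 0] *)
Definition gam (R : realType) (a : 'I_2) : 'M[R[i]]_2 :=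
  \matrix_(k, l)
    if k == l then 0
    else if a == 0 then (if k == 0 then 1 else -1)
    else Complex 0 1.

(* Spin(2), realized on C^2 as the unit elements of the even Clifford algebra *)
Definition spin2 (R : realType) (g : 'M[R[i]]_2) :=
  exists s t : R, s ^+ 2 + t ^+ 2 = 1 /\
    g = (Complex s 0)%:M + Complex t 0 *: (gam R 0 *m gam R 1).

(* linear in the first argument, conjugate-linear in the second *)
Definition herm (R : realType) (u v : 'cV[R[i]]_2) : R[i] :=
  \sum_(k < 2) u k 0 * (v k 0)^*.

Lemma gam_clifford (R : realType) (a b : 'I_2) :
  gam R a *m gam R b + gam R b *m gam R a = (- 2 * (a == b)%:R)%:M.
Proof.
apply/matrixP => k l; rewrite !mxE !big_ord_recl !big_ord0 !mxE.
case: a => -[|[|//]] ?; case: b => -[|[|//]] ?; case: k => -[|[|//]] ?;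
  case: l => -[|[|//]] ? /=; apply/eqP; rewrite eq_complex /=;
  by rewrite -?[2%:R]/(1 + 1) /= !(mul0r, mulr0, mul1r, mulr1, add0r, addr0,
    oppr0, mulNr, mulrN, opprK, subr0, sub0r, subrr, addNr, opprD, eqxx).
Qed.

Lemma herm_gam_skew (R : realType) (a : 'I_2) (u v : 'cV[R[i]]_2) :
  herm u (gam R a *m v) = - herm (gam R a *m u) v.
Proof.
rewrite /herm !big_ord_recl !big_ord0 !mxE !big_ord_recl !big_ord0 !mxE /=.
set u0 := u 0 0; set u1 := u _ 0; set v0 := v 0 0; set v1 := v _ 0.
case: u0 u1 v0 v1 => [? ?] [? ?] [? ?] [? ?].
case: a => -[|[|//]] ? /=; apply/eqP; rewrite eq_complex /=; apply/andP;
  split; apply/eqP; ring.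
Qed.

(* A spin structure in cocycle form: local orthonormal frames
   (frame a 0, frame a 1) over an open cover (sdom a), and smooth
   Spin(2)-valued functions [slift a b] on the overlaps that satisfy the cocycle
   condition and lift the transition functions
     frame b beta = \sum_alpha h(frame a alpha, frame b beta) frame a alpha
   along the double cover g |-> (v |-> g v g^-1) of SO(2) by Spin(2). In
   particular the frames define an orientation. *)
Record spin_structure (R : realType) (M : closed_surface R)
    (h : riem_metric M) := SpinStructure {
  sidx : Type ;
  sdom : sidx -> set M ;
  frame : sidx -> 'I_2 -> cidx M -> M -> 'rV[R]_2 ;
  slift : sidx -> sidx -> M -> 'M[R[i]]_2 ;
  sdom_open : forall a, open (sdom a) ;
  sdom_cover : forall p, exists a, sdom a p ;
  frame_field : forall a al, vector_field_on (sdom a) (frame a al) ;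
  frame_orthonormal : forall a i p (al be : 'I_2), sdom a p -> cdom i p ->
    hdot h i p (frame a al i p) (frame a be i p) = (al == be)%:R ;
  slift_smooth : forall a b i (k l : 'I_2),
    smooth_cfun i (sdom a `&` sdom b) (fun p => slift a b p k l) ;
  slift_spin : forall a b p, sdom a p -> sdom b p -> spin2 (slift a b p) ;
  slift_cocycle : forall a b c p, sdom a p -> sdom b p -> sdom c p ->
    slift a b p *m slift b c p = slift a c p ;
  slift_cover : forall a b i p (be : 'I_2),
    sdom a p -> sdom b p -> cdom i p ->
    slift a b p *m gam R be =
    (\sum_(al < 2)
       Complex (hdot h i p (frame a al i p) (frame b be i p)) 0 *: gam R al)
      *m slift a b p
}.

(* A smooth section of the spinor bundle, the bundle associated with the
   cocycle [slift] and the representation of Spin(2) on C^2. *)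
Record spinor (R : realType) (M : closed_surface R) (h : riem_metric M)
    (S : spin_structure h) := Spinor {
  spinor_val :> sidx S -> M -> 'cV[R[i]]_2 ;
  spinor_smooth : forall a i (k : 'I_2),
    smooth_cfun i (sdom a) (fun p => spinor_val a p k 0) ;
  spinor_change : forall a b p, sdom a p -> sdom b p ->
    spinor_val a p = slift a b p *m spinor_val b p
}.

(* Clifford multiplication by the tangent vector v at p, in the trivialization
   a, v being given by its components in the chart i *)
Definition cliff (R : realType) (M : closed_surface R) (h : riem_metric M)
    (S : spin_structure h) (a : sidx S) (i : cidx M) (p : M)
    (v : 'rV[R]_2) : 'M[R[i]]_2 :=
  \sum_(al < 2) Complex (hdot h i p v (frame a al i p)) 0 *: gam R al.

(* The spin connection, induced by the Levi-Civita connection: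
   v(psi) + 1/4 \sum_(be, ga) h(nabla_v e_be, e_ga) e_be . e_ga . psi *)
Definition spin_conn (R : realType) (M : closed_surface R)
    (h : riem_metric M) (S : spin_structure h) (psi : spinor S)
    (a : sidx S) (i : cidx M) (p : M) (v : 'rV[R]_2) : 'cV[R[i]]_2 :=
  \col_(k < 2) cderive (fun x => psi a (param i x) k 0) (coord i p) v +
  4^-1 *: \sum_(be < 2) \sum_(ga < 2)
    Complex (hdot h i p (levi_civita h i p v (frame a be))
                        (frame a ga i p)) 0 *:
      (gam R be *m gam R ga *m psi a p).

Definition dirac (R : realType) (M : closed_surface R)
    (h : riem_metric M) (S : spin_structure h) (psi : spinor S)
    (a : sidx S) (i : cidx M) (p : M) : 'cV[R[i]]_2 :=
  \sum_(al < 2) cliff a i p (frame a al i p) *m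
                spin_conn psi a i p (frame a al i p).

Definition sqnorm (R : realType) (M : closed_surface R)
    (h : riem_metric M) (S : spin_structure h) (q : nat)
    (psi : 'I_q -> spinor S) (a : sidx S) (p : M) : R[i] :=
  \sum_(j < q) herm (psi j a p) (psi j a p).

(* Local expressions in a trivialization a and a chart i do not depend on the
   choice of a and i, so equations between sections are required in all. *)
Definition dirac_equation (R : realType) (M : closed_surface R)
    (h : riem_metric M) (S : spin_structure h) (q : nat)
    (lambda kappa : R) (psi : 'I_q -> spinor S) :=
  forall (j : 'I_q) (a : sidx S) (i : cidx M) (p : M),
    sdom a p -> cdom i p ->
    dirac (psi j) a i p =
    Complex lambda 0 *: psi j a p +
    (Complex kappa 0 * sqnorm psi a p) *: psi j a p.

(* the complex-valued one-form v |-> <psi, v . phi> *)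
Definition current (R : realType) (M : closed_surface R)
    (h : riem_metric M) (S : spin_structure h) (psi phi : spinor S)
    (a : sidx S) (i : cidx M) (p : M) (v : 'rV[R]_2) : R[i] :=
  herm (psi a p) (cliff a i p v *m phi a p).

(* (nabla_v J)(Y) = v(J(Y)) - J(nabla_v Y) for the one-form J, summed over
   v = Y = e_alpha *)
Definition div_current (R : realType) (M : closed_surface R)
    (h : riem_metric M) (S : spin_structure h) (psi phi : spinor S)
    (a : sidx S) (i : cidx M) (p : M) : R[i] :=
  \sum_(al < 2)
    (cderive (fun x => let y := param i x in
                current psi phi a i y (frame a al i y))
             (coord i p) (frame a al i p) -
     current psi phi a i p
       (levi_civita h i p (frame a al i p) (frame a al))).

(* Main.v *)
(* Differentiating <psi, e_al . phi> along e_al and summing gives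
   div J = <psi, D phi> - <D psi, phi> for all spinors psi, phi, where D is the
   Dirac operator. Indeed the partial derivatives differ from the spin connection
   by the skew-Hermitian connection form omega, whose commutator with e_al is
   the Levi-Civita derivative of e_al; both facts come from the skew-symmetry of
   h(nabla e_be, e_ga) for an orthonormal frame. For solutions of the equation,
   D psi^j = c psi^j with the same real function c = lambda + kappa |psi|^2 for
   all j, so the right-hand side vanishes. *)
Require Import Defs.
From mathcomp Require Import all_boot all_order all_algebra.
From mathcomp Require Import all_classical all_reals all_analysis.
From mathcomp Require Import complex ring lra.

Set Implicit Arguments.
Unset Strict Implicit.
Unset Printing Implicit Defensive.

Import Order.TTheory GRing.Theory Num.Theory.
Import Defs numFieldNormedType.Exports.
Local Open Scope classical_set_scope.
Local Open Scope ring_scope.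

(** * Derivatives along vectors *)

(** Both derivatives are limits of the same difference quotient; this makes one-variable calculus
    available along a line. *)
Lemma is_derive_line (R : realType) (V : normedModType R) (f : V -> R)
    (x e : V) (t : R) :
  derivable f (t *: e + x) e ->
  is_derive t 1 (fun s : R => f (s *: e + x)) ('D_e f (t *: e + x)).
Proof.
move=> df.
have E : (fun h : R => h^-1 *: (((fun s : R => f (s *: e + x)) \o shift t)
    (h *: 1) - f (t *: e + x)))
  = (fun h : R => h^-1 *: ((f \o shift (t *: e + x)) (h *: e) -
      f (t *: e + x))).
  by apply/funext => h /=; rewrite [h *: 1]mulr1 scalerDl addrA.
by split; rewrite /derivable /derive E.
Qed.

(** The bound on [|t|], in place of an interval, covers both signs of [s]; for negative [s] the mean
    value theorem is applied on [[s, 0]]. *)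
Lemma mean_value_line (R : realType) (V : normedModType R) (f : V -> R)
    (x e : V) (s : R) :
  (forall t : R, `|t| <= `|s| -> derivable f (t *: e + x) e) ->
  exists2 t : R, `|t| <= `|s| & f (s *: e + x) - f x = s * 'D_e f (t *: e + x).
Proof.
move=> df.
have dg (t : R) : `|t| <= `|s| -> is_derive t 1 (fun u : R => f (u *: e + x))
    ('D_e f (t *: e + x)) by move=> /df /is_derive_line.
have cg (a b : R) : (forall t, t \in `[a, b] -> `|t| <= `|s|) ->
    {within `[a, b], continuous (fun u : R => f (u *: e + x))}.
  move=> ab; apply: derivable_within_continuous => t /ab /dg dt.
  exact: ex_derive.
have E0 : f x = f (0 *: e + x) by rewrite scale0r add0r.
have [s0|s0] := leP 0 s.
- have ab t : t \in `[0, s] -> `|t| <= `|s|.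
    by rewrite in_itv /= => /andP[t0 ts]; rewrite !ger0_norm.
  have [|t tI E] := MVT_segment (df := fun u => 'D_e f (u *: e + x))
      s0 _ (cg _ _ ab).
    by move=> t /subset_itv_oo_cc /ab /dg.
  by exists t; [exact: ab|rewrite E0 E subr0 mulrC].
- have ab t : t \in `[s, 0] -> `|t| <= `|s|.
    by rewrite in_itv /= => /andP[t0 ts]; rewrite !ler0_norm ?lerN2 // ltW.
  have [|t tI E] := MVT_segment (df := fun u => 'D_e f (u *: e + x))
      (ltW s0) _ (cg _ _ ab).
    by move=> t /subset_itv_oo_cc /ab /dg.
  by exists t; [exact: ab|rewrite E0 -opprB E sub0r mulrN opprK mulrC].
Qed.

(* Moving along the coordinate directions one at a time, the mean value theorem
   writes each difference as a partial derivative at a point close to x. *)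
Lemma is_derive_partials (R : realType) (f : 'rV[R]_2 -> R) (x v : 'rV[R]_2) :
  (\forall y \near x, forall k : 'I_2, derivable f y (delta_mx 0 k)) ->
  (forall k : 'I_2, {for x, continuous (fun y => 'D_(delta_mx 0 k) f y)}) ->
  is_derive x v f (\sum_(k < 2) v 0 k * 'D_(delta_mx 0 k) f x).
Proof.
move=> df cf.
set L := \sum_(k < 2) _.
suff H : h^-1 *: ((f \o shift x) (h *: v) - f x) @[h --> 0^'] --> L.
  by split; [apply/cvg_ex; exists L|exact: cvg_lim H].
apply/cvgrPdist_le => eps eps0 /=.
(* Errors of at most [eps / N] in both partial derivatives, weighted by the components of [v], add
   up to at most [eps]; the [1] keeps [N] positive when [v] is zero. *)
pose N := `|v 0 0| + `|v 0 1| + 1.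
have N0 : 0 < N by rewrite /N; have := normr_ge0 (v 0 0);
  have := normr_ge0 (v 0 1); lra.
have eN : 0 < eps / N by rewrite divr_gt0.
have cfN k : \forall y \near x,
    `|'D_(delta_mx 0 k) f x - 'D_(delta_mx 0 k) f y| <= eps / N.
  by have /cvgrPdist_le := cf k; apply.
have : \forall y \near x, [/\ forall k : 'I_2, derivable f y (delta_mx 0 k),
    `|'D_(delta_mx 0 0) f x - 'D_(delta_mx 0 0) f y| <= eps / N &
    `|'D_(delta_mx 0 1) f x - 'D_(delta_mx 0 1) f y| <= eps / N].
  near=> y; split; near: y => //; exact: cfN.
move=> /nbhs_ballP[d /= d0 dP].
pose e0 : 'rV[R]_2 := delta_mx 0 0; pose e1 : 'rV[R]_2 := delta_mx 0 1.
(* All points on the two legs of the path from [x] to [x + h v] lie within [|h| * C] of [x]. *)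
pose C := `|v 0 0| * `|e0| + `|v 0 1| * `|e1| + 1.
have C0 : 0 < C by rewrite /C; apply: ltr_wpDl => //; rewrite addr_ge0 ?mulr_ge0.
have vE : v = v 0 1 *: e1 + v 0 0 *: e0.
  apply/rowP => k; rewrite !mxE /=; case: k => -[|[|//]] kp /=;
  rewrite ?mulr1 ?mulr0 ?addr0 ?add0r; congr (v 0 _); exact/val_inj.
near=> h.
have h0 : h != 0 by near: h; exact: nbhs_dnbhs_neq.
have hC : `|h| * C < d.
  rewrite -ltr_pdivlMr //; near: h; apply: dnbhs0_lt; exact: divr_gt0.
have near_x (s t : R) : `|s| <= `|h * v 0 0| -> `|t| <= `|h * v 0 1| ->
    ball x d (t *: e1 + (s *: e0 + x)).
  move=> sh th; rewrite -ball_normE /= addrA opprD addrCA subrr addr0 normrN.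
  apply: le_lt_trans hC; apply: (le_trans (ler_normD _ _)).
  rewrite !normrZ; move: sh th; rewrite !normrM => sh th.
  rewrite /C mulrDr mulr1 mulrDr !mulrA.
  have := ler_wpM2r (normr_ge0 e0) sh; have := ler_wpM2r (normr_ge0 e1) th.
  have := normr_ge0 h; lra.
have near_x0 (s : R) : `|s| <= `|h * v 0 0| -> ball x d (s *: e0 + x).
  by move=> sh; have := near_x s 0 sh; rewrite scale0r add0r normr0; apply.
have [|s sh Es] := @mean_value_line R _ f x e0 (h * v 0 0).
  by move=> t /near_x0 /dP[D _ _]; exact: D.
have [|t th Et] :=
    @mean_value_line R _ f ((h * v 0 0) *: e0 + x) e1 (h * v 0 1).
  by move=> t /(near_x _ _ (lexx _)) /dP[D _ _]; exact: D.
have [_ B0 _] := dP _ (near_x0 s sh).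
have [_ _ B1] := dP _ (near_x _ t (lexx _) th).
(* Inserting the corner of the path and dividing by [h] gives an exact formula for the difference
   quotient. *)
have -> : h^-1 *: ((f \o shift x) (h *: v) - f x) =
    v 0 1 * 'D_e1 f (t *: e1 + ((h * v 0 0) *: e0 + x)) +
    v 0 0 * 'D_e0 f (s *: e0 + x).
  have -> : (f \o shift x) (h *: v) =
      f ((h * v 0 1) *: e1 + ((h * v 0 0) *: e0 + x)).
    by rewrite /= [in LHS]vE scalerDr !scalerA -addrA.
  rewrite -[_ - f x](subrKA (f ((h * v 0 0) *: e0 + x))) Es Et.
  by rewrite -!mulrA -mulrDr [_ *: _]mulrA mulVf // mul1r.
rewrite /L !big_ord_recl big_ord0 addr0.
have -> : lift ord0 ord0 = 1 :> 'I_2 by exact/val_inj.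
rewrite -[ord0]/(0 : 'I_2) -/e0 -/e1.
set a0 := 'D_e0 f x in B0 *; set a1 := 'D_e1 f x in B1 *.
set b0 := 'D_e0 f _ in B0 *; set b1 := 'D_e1 f _ in B1 *.
have -> : v 0 0 * a0 + v 0 1 * a1 - (v 0 1 * b1 + v 0 0 * b0) =
  v 0 0 * (a0 - b0) + v 0 1 * (a1 - b1) by ring.
apply: (le_trans (ler_normD _ _)); rewrite !normrM.
have : `|v 0 0| * `|a0 - b0| <= `|v 0 0| * (eps / N) by exact: ler_wpM2l.
have : `|v 0 1| * `|a1 - b1| <= `|v 0 1| * (eps / N) by exact: ler_wpM2l.
have : eps = `|v 0 0| * (eps / N) + `|v 0 1| * (eps / N) + eps / N.
  by rewrite -mulrDl -[X in _ + X]mul1r -mulrDl -/N mulrC divfK // gt_eqF.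
lra.
Unshelve. all: by end_near. Qed.

(** Smoothness speaks of coordinate directions only; continuity of the first partial derivatives
    extends derivability to every direction [v]. *)
Lemma smooth_on_is_derive (R : realType) (D : set 'rV[R]_2)
    (f : 'rV[R]_2 -> R) (x v : 'rV[R]_2) :
  open D -> smooth_on D f -> D x ->
  is_derive x v f (\sum_(k < 2) v 0 k * 'D_(delta_mx 0 k) f x).
Proof.
move=> oD sf Dx; apply: is_derive_partials.
- near=> y => k; have Dy : D y by near: y; exact: open_nbhs_nbhs.
  by have [_ ] := sf [::] y Dy; apply.
- by move=> k; have [] := sf [:: k] x Dx.
Unshelve. all: by end_near. Qed.

(** * The Levi-Civita connection in a chart *)

(** Inside the open chart image, the set is the preimage of [W] under the continuous map
    [param i]. *)
Lemma coord_image_open (R : realType) (M : closed_surface R) (i : cidx M)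
    (W : set M) : open W -> open (coord i @` (cdom i `&` W)).
Proof.
move=> oW; rewrite openE => _ [p [ip Wp] <-].
have cip : (coord i @` cdom i) (coord i p) by exists p.
have nW : nbhs (coord i p) (param i @^-1` W).
  apply: (param_cont cip); rewrite coordK //.
  exact: open_nbhs_nbhs.
have nC : nbhs (coord i p) (coord i @` cdom i).
  by apply: open_nbhs_nbhs; split => //; exact: cimg_open.
apply: filterS (filterI nW nC) => x [Wx [y iy yx]].
by exists y => //; split => //; move: Wx; rewrite -yx /preimage /= coordK.
Qed.

(** Identities that hold only on [W] and the chart domain may thus be used under a derivative at
    [coord i p], which depends on germs alone. *)
Lemma near_chart (R : realType) (M : closed_surface R) (i : cidx M)
    (W : set M) (p : M) : open W -> W p -> cdom i p ->
  \forall x \near coord i p, W (param i x) /\ cdom i (param i x).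
Proof.
move=> oW Wp ip.
have : nbhs (coord i p) (coord i @` (cdom i `&` W)).
  by apply: open_nbhs_nbhs; split; [exact: coord_image_open|exists p].
by apply: filterS => _ [y [iy Wy] <-]; rewrite coordK.
Qed.

Lemma smooth_fun_is_derive (R : realType) (M : closed_surface R) (i : cidx M)
    (W : set M) (f : M -> R) (p : M) (v : 'rV[R]_2) :
  open W -> smooth_fun i W f -> W p -> cdom i p ->
  is_derive (coord i p) v (fun x => f (param i x))
    (\sum_(k < 2) v 0 k *
       'D_(delta_mx 0 k) (fun x => f (param i x)) (coord i p)).
Proof.
move=> oW sf Wp ip; apply: smooth_on_is_derive sf _; last by exists p.
exact: coord_image_open.
Qed.

Lemma smooth_fun_derivable (R : realType) (M : closed_surface R) (i : cidx M)
    (W : set M) (f : M -> R) (p : M) (v : 'rV[R]_2) :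
  open W -> smooth_fun i W f -> W p -> cdom i p ->
  is_derive (coord i p) v (fun x => f (param i x))
    ('D_v (fun x => f (param i x)) (coord i p)).
Proof.
by move=> oW sf Wp ip; have [df _] := smooth_fun_is_derive v oW sf Wp ip; split.
Qed.

(** A nonzero vector in the kernel would have length zero, against positivity. *)
Lemma metric_unit (R : realType) (M : closed_surface R) (h : riem_metric M)
    (i : cidx M) (p : M) : cdom i p -> metric h i p \in unitmx.
Proof.
move=> ip; rewrite -row_free_unit -kermx_eq0; apply/rowV0P => u /sub_kermxP uG.
apply/eqP/negP => /negP /(metric_pos h ip).
by rewrite uG mul0mx mxE ltxx.
Qed.

Lemma invmx_metric_sym (R : realType) (M : closed_surface R)
    (h : riem_metric M) (i : cidx M) (p : M) :
  cdom i p -> (invmx (metric h i p))^T = invmx (metric h i p).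
Proof. by move=> ip; rewrite trmx_inv metric_sym. Qed.

Lemma dmetric_sym (R : realType) (M : closed_surface R) (h : riem_metric M)
    (i : cidx M) (p : M) (l m n : 'I_2) :
  cdom i p -> dmetric h i p l m n = dmetric h i p l n m.
Proof.
move=> ip; apply: near_eq_derive.
near=> x; have [_ ix] : setT (param i x) /\ cdom i (param i x).
  by near: x; exact: (near_chart openT).
by rewrite -[in LHS](metric_sym h ix) mxE.
Unshelve. all: by end_near. Qed.

(** Lowering the upper index cancels the inverse metric and leaves the Christoffel symbols of the
    first kind. *)
Lemma hdot_christoffel (R : realType) (M : closed_surface R)
    (h : riem_metric M) (i : cidx M) (p : M) (v y z : 'rV[R]_2) :
  cdom i p ->
  hdot h i p
    (\row_(k < 2) \sum_(l < 2) \sum_(m < 2)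
       christoffel h i p k l m * v 0 l * y 0 m) z =
  \sum_(n < 2) \sum_(l < 2) \sum_(m < 2) v 0 l * y 0 m * z 0 n * 2^-1 *
    (dmetric h i p l m n + dmetric h i p m l n - dmetric h i p n l m).
Proof.
(* [b] is the covector with lowered index; raising it by the symmetric inverse metric gives back the
   Christoffel term. *)
move=> ip; pose b : 'rV[R]_2 := \row_n \sum_(l < 2) \sum_(m < 2)
  v 0 l * y 0 m * 2^-1 *
    (dmetric h i p l m n + dmetric h i p m l n - dmetric h i p n l m).
set c := \row_k _.
have -> : c = b *m invmx (metric h i p).
  apply/rowP => k; rewrite -invmx_metric_sym // !mxE.
  under [RHS]eq_bigr do rewrite !mxE.
  rewrite /christoffel; move: (invmx _) (dmetric h i p) => A d.
  by rewrite !big_ord_recl !big_ord0; ring.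
rewrite /hdot mulmxKV ?metric_unit // mxE; apply: eq_bigr => n _.
rewrite !mxE mulr_suml; apply: eq_bigr => l _.
by rewrite mulr_suml; apply: eq_bigr => m _; ring.
Qed.

Lemma hdotE (R : realType) (M : closed_surface R) (h : riem_metric M)
    (i : cidx M) (p : M) (u v : 'rV[R]_2) :
  hdot h i p u v =
  \sum_(m < 2) \sum_(n < 2) u 0 m * metric h i p m n * v 0 n.
Proof.
rewrite /hdot mxE exchange_big; apply: eq_bigr => n _.
by rewrite !mxE mulr_suml.
Qed.

Lemma hdotDl (R : realType) (M : closed_surface R) (h : riem_metric M)
    (i : cidx M) (p : M) (u v w : 'rV[R]_2) :
  hdot h i p (u + v) w = hdot h i p u w + hdot h i p v w.
Proof. by rewrite /hdot !mulmxDl mxE. Qed.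

(** Compatibility with the metric: in the product rule, the derivative of the metric is the sum of
    two Christoffel symbols of the first kind, whose other terms cancel by symmetry. *)
Lemma levi_civita_hdot (R : realType) (M : closed_surface R)
    (h : riem_metric M) (i : cidx M) (W : set M) (p : M) (v : 'rV[R]_2)
    (Y Z : cidx M -> M -> 'rV[R]_2) :
  open W -> vector_field_on W Y -> vector_field_on W Z -> W p -> cdom i p ->
  'D_v (fun x => hdot h i (param i x) (Y i (param i x)) (Z i (param i x)))
    (coord i p) =
  hdot h i p (levi_civita h i p v Y) (Z i p) +
  hdot h i p (levi_civita h i p v Z) (Y i p).
Proof.
move=> oW [sY _] [sZ _] Wp ip.
pose y (m : 'I_2) x := Y i (param i x) 0 m.
pose z (m : 'I_2) x := Z i (param i x) 0 m.
pose g (m n : 'I_2) x := metric h i (param i x) m n.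
have dy m : is_derive (coord i p) v (y m) ('D_v (y m) (coord i p)).
  exact: (smooth_fun_derivable v oW (sY i m)).
have dz m : is_derive (coord i p) v (z m) ('D_v (z m) (coord i p)).
  exact: (smooth_fun_derivable v oW (sZ i m)).
have dg m n : is_derive (coord i p) v (g m n)
    (\sum_(l < 2) v 0 l * dmetric h i p l m n).
  exact: (smooth_fun_is_derive v openT (metric_smooth h m n) I ip).
(* As a sum of products of functions, the scalar product fits the derivation rules, which then
   compute the value left open in [D]. *)
have -> : (fun x => hdot h i (param i x) (Y i (param i x)) (Z i (param i x)))
    = \sum_(m < 2) \sum_(n < 2) (y m * g m n * z n).
  apply/funext => x; rewrite hdotE fct_sumE; apply: eq_bigr => m _.
  by rewrite fct_sumE.
have D : is_derive (coord i p) v (\sum_(m < 2) \sum_(n < 2) (y m * g m n * z n))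
    _ := is_derive_sum (fun m => is_derive_sum (fun n =>
      is_deriveM (is_deriveM (dy m) (dg m n)) (dz n))).
rewrite (@derive_val _ _ _ _ _ _ _ D).
have lcE (X : cidx M -> M -> 'rV[R]_2) : levi_civita h i p v X =
    \row_k 'D_v (fun x => X i (param i x) 0 k) (coord i p) +
    \row_(k < 2) \sum_(l < 2) \sum_(m < 2)
       christoffel h i p k l m * v 0 l * X i p 0 m.
  by apply/rowP => k; rewrite !mxE.
rewrite !lcE !hdotDl !hdot_christoffel // !hdotE.
have yE m : y m (coord i p) = Y i p 0 m by rewrite /y coordK.
have zE m : z m (coord i p) = Z i p 0 m by rewrite /z coordK.
have gE m n : g m n (coord i p) = metric h i p m n by rewrite /g coordK.
have yE' m : 'D_v (fun x => Y i (param i x) 0 m) (coord i p) =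
  'D_v (y m) (coord i p) by [].
have zE' m : 'D_v (fun x => Z i (param i x) 0 m) (coord i p) =
  'D_v (z m) (coord i p) by [].
have gS m n : metric h i p m n = metric h i p n m.
  by rewrite -[in LHS](metric_sym h ip) mxE.
have dS l m n : dmetric h i p l m n = dmetric h i p l n m.
  exact: dmetric_sym.
transitivity (\sum_(m < 2) \sum_(n < 2)
  (Y i p 0 m * metric h i p m n * 'D_v (z n) (coord i p) + Z i p 0 n *
   (Y i p 0 m * (\sum_(l < 2) v 0 l * dmetric h i p l m n) +
    metric h i p m n * 'D_v (y m) (coord i p)))).
  apply: eq_bigr => m _; apply: eq_bigr => n _.
  by rewrite -yE -zE -gE.
under [X in _ = X + _ + _]eq_bigr do under eq_bigr do rewrite mxE yE'.
under [X in _ = _ + (X + _)]eq_bigr do under eq_bigr do rewrite mxE zE'.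
(* With all values abstracted and off-diagonal entries in one order, a rational identity remains. *)
move: gS dS; move: (metric h i p) (dmetric h i p) (Y i p) (Z i p) => G d u w.
move=> gS dS; rewrite !big_ord_recl !big_ord0.
rewrite !(gS (lift _ _) ord0) !(dS _ (lift _ _) ord0).
move: ('D_v (y ord0) _) ('D_v (y (lift _ _)) _) => y0 y1.
by move: ('D_v (z ord0) _) ('D_v (z (lift _ _)) _) => z0 z1; field.
Qed.

(** By metric compatibility the sum of the two products is the derivative of [h(e_be, e_ga)], which
    is constant near [p]. *)
Lemma levi_civita_frame_skew (R : realType) (M : closed_surface R)
    (h : riem_metric M) (S : spin_structure h) (a : sidx S) (i : cidx M)
    (p : M) (v : 'rV[R]_2) (be ga : 'I_2) :
  sdom a p -> cdom i p ->
  hdot h i p (levi_civita h i p v (frame a be)) (frame a ga i p) =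
  - hdot h i p (levi_civita h i p v (frame a ga)) (frame a be i p).
Proof.
move=> ap ip; apply/eqP; rewrite -addr_eq0.
rewrite -(levi_civita_hdot h v (@sdom_open _ _ _ S a)) //; try exact: frame_field.
apply/eqP; rewrite -(derive_cst ((be == ga)%:R : R) (coord i p) v).
apply: near_eq_derive; near=> x.
have [ax ix] : sdom a (param i x) /\ cdom i (param i x).
  by near: x; apply: near_chart => //; exact: sdom_open.
exact: frame_orthonormal.
Unshelve. all: by end_near. Qed.

Lemma cliff_frame (R : realType) (M : closed_surface R)
    (h : riem_metric M) (S : spin_structure h) (a : sidx S) (i : cidx M)
    (p : M) (al : 'I_2) :
  sdom a p -> cdom i p -> cliff a i p (frame a al i p) = gam R al.
Proof.
move=> ap ip; rewrite /cliff (bigD1 al) //= frame_orthonormal // eqxx.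
rewrite big1 ?addr0 => [|be nbe]; first exact: scale1r.
by rewrite frame_orthonormal // eq_sym (negPf nbe); exact: scale0r.
Qed.

(** * Complex-valued functions *)

(** [cderive] is total and says nothing about existence; this predicate carries derivability of both
    parts along with the value, as the sum and product rules require. *)
Definition is_cderive (R : realType) (x v : 'rV[R]_2) (f : 'rV[R]_2 -> R[i])
    (l : R[i]) :=
  is_derive x v (fun y => complex.Re (f y)) (complex.Re l) /\
  is_derive x v (fun y => complex.Im (f y)) (complex.Im l).

Lemma cderive_val (R : realType) (x v : 'rV[R]_2) (f : 'rV[R]_2 -> R[i])
    (l : R[i]) : is_cderive x v f l -> cderive f x v = l.
Proof. by case: l => lr li [[_ r] [_ m]]; rewrite /cderive r m. Qed.

Lemma is_cderive_cst (R : realType) (x v : 'rV[R]_2) (c : R[i]) :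
  is_cderive x v (fun=> c) 0.
Proof. by split; exact: is_derive_cst. Qed.

Lemma is_cderiveD (R : realType) (x v : 'rV[R]_2) (f g : 'rV[R]_2 -> R[i])
    (l m : R[i]) : is_cderive x v f l -> is_cderive x v g m ->
  is_cderive x v (fun y => f y + g y) (l + m).
Proof.
move=> [fr fi] [gr gi]; split.
- have := is_deriveD fr gr.
  congr (is_derive _ _ _ _); last by case: l m {fr fi gr gi} => ? ? [].
  apply/funext => y; rewrite -[LHS]/(complex.Re (f y) + complex.Re (g y)).
  by case: (f y) (g y) => ? ? [].
- have := is_deriveD fi gi.
  congr (is_derive _ _ _ _); last by case: l m {fr fi gr gi} => ? ? [].
  apply/funext => y; rewrite -[LHS]/(complex.Im (f y) + complex.Im (g y)).
  by case: (f y) (g y) => ? ? [].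
Qed.

Lemma is_cderiveM (R : realType) (x v : 'rV[R]_2) (f g : 'rV[R]_2 -> R[i])
    (l m : R[i]) : is_cderive x v f l -> is_cderive x v g m ->
  is_cderive x v (fun y => f y * g y) (l * g x + f x * m).
Proof.
move=> [fr fi] [gr gi]; split.
- have := is_deriveB (is_deriveM fr gr) (is_deriveM fi gi).
  congr (is_derive _ _ _ _).
    apply/funext => y; rewrite -[LHS]/(complex.Re (f y) * complex.Re (g y) -
      complex.Im (f y) * complex.Im (g y)).
    by case: (f y) (g y) => ? ? [].
  (* The product rule states its value with the scaling of [R] on itself, which [ring] has to see as
     multiplication. *)
  by case: l m (f x) (g x) {fr fi gr gi} => ? ? [? ?] [? ?] [? ?] /=;
    rewrite -![_ *: _]/(_ * _); ring.
- have := is_deriveD (is_deriveM fr gi) (is_deriveM fi gr).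
  congr (is_derive _ _ _ _).
    apply/funext => y; rewrite -[LHS]/(complex.Re (f y) * complex.Im (g y) +
      complex.Im (f y) * complex.Re (g y)).
    by case: (f y) (g y) => ? ? [].
  by case: l m (f x) (g x) {fr fi gr gi} => ? ? [? ?] [? ?] [? ?] /=;
    rewrite -![_ *: _]/(_ * _); ring.
Qed.

Lemma is_cderive_conj (R : realType) (x v : 'rV[R]_2) (f : 'rV[R]_2 -> R[i])
    (l : R[i]) : is_cderive x v f l ->
  is_cderive x v (fun y => (f y)^*) (l^*).
Proof.
move=> [fr fi]; split.
- by move: fr; congr (is_derive _ _ _ _);
    [apply/funext => y; case: (f y)|case: l {fi}].
- have := is_deriveN fi.
  by congr (is_derive _ _ _ _);
    [apply/funext => y; rewrite -[LHS]/(- complex.Im (f y)); case: (f y)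
    |case: l {fr fi}].
Qed.

Lemma is_cderive_sum (R : realType) (x v : 'rV[R]_2) (n : nat)
    (f : 'I_n -> 'rV[R]_2 -> R[i]) (l : 'I_n -> R[i]) :
  (forall k, is_cderive x v (f k) (l k)) ->
  is_cderive x v (fun y => \sum_(k < n) f k y) (\sum_(k < n) l k).
Proof.
move=> fl; elim: n => [|n IH] in f l fl *.
  rewrite big_ord0; under eq_fun do rewrite big_ord0; exact: is_cderive_cst.
rewrite big_ord_recl; under eq_fun do rewrite big_ord_recl.
by apply: is_cderiveD => //; exact: IH.
Qed.

Lemma is_cderive_herm (R : realType) (x v : 'rV[R]_2)
    (A : 'M[R[i]]_2) (u w : 'rV[R]_2 -> 'cV[R[i]]_2) (du dw : 'cV[R[i]]_2) :
  (forall k, is_cderive x v (fun y => u y k 0) (du k 0)) ->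
  (forall k, is_cderive x v (fun y => w y k 0) (dw k 0)) ->
  is_cderive x v (fun y => herm (u y) (A *m w y))
    (herm du (A *m w x) + herm (u x) (A *m dw)).
Proof.
move=> hu hw; rewrite /herm -big_split /=; apply: is_cderive_sum => k.
apply: is_cderiveM => //; apply: is_cderive_conj.
under eq_fun do rewrite mxE.
rewrite mxE; apply: is_cderive_sum => l.
have := is_cderiveM (is_cderive_cst x v (A k l)) (hw l).
by rewrite mul0r add0r.
Qed.

(** * Spinors *)

Lemma hermDl (R : realType) (u v w : 'cV[R[i]]_2) :
  herm (u + v) w = herm u w + herm v w.
Proof.
by rewrite /herm -big_split; apply: eq_bigr => k _; rewrite mxE mulrDl.
Qed.

Lemma hermDr (R : realType) (u v w : 'cV[R[i]]_2) :
  herm u (v + w) = herm u v + herm u w.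
Proof.
by rewrite /herm -big_split; apply: eq_bigr => k _; rewrite mxE rmorphD mulrDr.
Qed.

Lemma hermZl (R : realType) (c : R[i]) (u v : 'cV[R[i]]_2) :
  herm (c *: u) v = c * herm u v.
Proof. by rewrite /herm mulr_sumr; apply: eq_bigr => k _; rewrite mxE mulrA. Qed.

Lemma hermZr (R : realType) (c : R[i]) (u v : 'cV[R[i]]_2) :
  herm u (c *: v) = c^* * herm u v.
Proof.
by rewrite /herm mulr_sumr; apply: eq_bigr => k _; rewrite mxE rmorphM mulrCA.
Qed.

Lemma hermNr (R : realType) (u v : 'cV[R[i]]_2) : herm u (- v) = - herm u v.
Proof. by rewrite -scaleN1r hermZr rmorphN1 mulN1r. Qed.

Lemma herm_conj (R : realType) (u v : 'cV[R[i]]_2) : (herm u v)^* = herm v u.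
Proof.
rewrite /herm rmorph_sum; apply: eq_bigr => k _.
by rewrite rmorphM /= conjCK mulrC.
Qed.

Lemma conj_real (R : realType) (r : R) : (Complex r 0)^* = Complex r 0.
Proof. by rewrite /= /Num.conj /= oppr0. Qed.

(** [sqnorm] has its values in [R[i]]; its reality comes from Hermitian symmetry. *)
Lemma sqnorm_conj (R : realType) (M : closed_surface R) (h : riem_metric M)
    (S : spin_structure h) (q : nat) (psi : 'I_q -> spinor S) (a : sidx S)
    (p : M) : (sqnorm psi a p)^* = sqnorm psi a p.
Proof.
rewrite /sqnorm rmorph_sum; apply: eq_bigr => k _; exact: herm_conj.
Qed.

(** For [w be ga] equal to [h(nabla_v e_be, e_ga)] this is the spin connection form evaluated at
    [v]. *)
Definition spin_form (R : realType) (w : 'I_2 -> 'I_2 -> R) : 'M[R[i]]_2 :=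
  4^-1 *: \sum_(be < 2) \sum_(ga < 2)
    Complex (w be ga) 0 *: (gam R be *m gam R ga).

Lemma gam_anticomm (R : realType) : gam R 1 *m gam R 0 = - (gam R 0 *m gam R 1).
Proof.
apply/eqP; rewrite -addr_eq0 gam_clifford.
by apply/eqP/matrixP => k l; rewrite !mxE mulr0 mul0rn.
Qed.

(** The diagonal of [w] vanishes, and the two mixed terms agree because [w] is skew and the gammas
    anticommute; hence twice the factor [1/4]. *)
Lemma spin_formE (R : realType) (w : 'I_2 -> 'I_2 -> R) :
  (forall be ga, w be ga = - w ga be) ->
  spin_form w = Complex (w 0 1 / 2) 0 *: (gam R 0 *m gam R 1).
Proof.
move=> sw; rewrite /spin_form !big_ord_recl !big_ord0.
have -> : lift ord0 ord0 = 1 :> 'I_2 by exact/val_inj.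
have w0 k : w k k = 0 by have := sw k k; lra.
rewrite -[ord0]/(0 : 'I_2) !w0 -[Complex 0 0]/(0 : R[i]) !scale0r !addr0 !add0r.
rewrite gam_anticomm (sw 1 0) scalerN.
rewrite -scaleNr -scalerDl scalerA; congr (_ *: _).
(* As an embedded real number, the factor lets the equation split into real and imaginary parts. *)
have -> : (4^-1 : R[i]) = Complex (4^-1) 0.
  by rewrite -[RHS]/(real_complex R 4^-1) fmorphV rmorph_nat.
by apply/eqP; rewrite eq_complex /=; apply/andP; split; apply/eqP; field.
Qed.

(** Each gamma is skew-adjoint, so the adjoint of their product is the reversed product, which is
    its negative; the coefficient is real. *)
Lemma herm_spin_form (R : realType) (w : 'I_2 -> 'I_2 -> R)
    (u v : 'cV[R[i]]_2) : (forall be ga, w be ga = - w ga be) ->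
  herm (spin_form w *m u) v = - herm u (spin_form w *m v).
Proof.
move=> sw; rewrite spin_formE // -!scalemxAl hermZl hermZr conj_real.
rewrite -!mulmxA -[herm (gam R 0 *m _) v]opprK -herm_gam_skew.
rewrite -[herm (gam R 1 *m _) _]opprK -herm_gam_skew opprK mulmxA gam_anticomm.
by rewrite mulNmx hermNr mulrN !mulmxA.
Qed.

(* The infinitesimal form of the double cover of SO(2) by Spin(2). *)
Lemma gam_spin_form (R : realType) (w : 'I_2 -> 'I_2 -> R) (al : 'I_2) :
  (forall be ga, w be ga = - w ga be) ->
  gam R al *m spin_form w =
  spin_form w *m gam R al - \sum_(ga < 2) Complex (w al ga) 0 *: gam R ga.
Proof.
move=> sw; rewrite spin_formE // -scalemxAl -scalemxAr.
rewrite !big_ord_recl !big_ord0.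
have -> : lift ord0 ord0 = 1 :> 'I_2 by exact/val_inj.
have w0 k : w k k = 0 by have := sw k k; lra.
have w10 := sw 1 0.
have al01 : al = 0 \/ al = 1.
  by case: al => -[|[|//]] ?; [left|right]; exact/val_inj.
(* Only the number [w 0 1] is left, and the identity is checked entry by entry for both values of
   [al]. *)
apply/matrixP => k l; rewrite !(mxE, big_ord_recl, big_ord0).
by case: al01 => ->; rewrite -[ord0]/(0 : 'I_2) ?w0 ?w10;
  move: (w 0 1) => r; case: k => -[|[|//]] ?;
  case: l => -[|[|//]] ? /=; apply/eqP; rewrite eq_complex /=;
  apply/andP; split; apply/eqP; field.
Qed.

(** * Derivatives of spinors and the divergence of the current *)

Lemma near_eq_cderive (R : realType) (f g : 'rV[R]_2 -> R[i])
    (x v : 'rV[R]_2) :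
  (\forall y \near x, f y = g y) -> cderive f x v = cderive g x v.
Proof.
by move=> fg; rewrite /cderive; congr Complex; apply: near_eq_derive;
  apply: filterS fg => y ->.
Qed.

(** The flat part of the spin connection in the trivialization [a]; the connection form is added in
    [spin_connE]. *)
Definition spinor_derive (R : realType) (M : closed_surface R)
    (h : riem_metric M) (S : spin_structure h) (psi : spinor S)
    (a : sidx S) (i : cidx M) (p : M) (v : 'rV[R]_2) : 'cV[R[i]]_2 :=
  \col_(k < 2) cderive (fun x => psi a (param i x) k 0) (coord i p) v.

Lemma spinor_is_cderive (R : realType) (M : closed_surface R)
    (h : riem_metric M) (S : spin_structure h) (psi : spinor S)
    (a : sidx S) (i : cidx M) (p : M) (v : 'rV[R]_2) (k : 'I_2) :
  sdom a p -> cdom i p ->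
  is_cderive (coord i p) v (fun x => psi a (param i x) k 0)
    (spinor_derive psi a i p v k 0).
Proof.
move=> ap ip; have [sr si] := spinor_smooth psi a i k.
have oa := @sdom_open _ _ _ S a; rewrite mxE /cderive.
by split; [exact: (smooth_fun_derivable v oa sr)
          |exact: (smooth_fun_derivable v oa si)].
Qed.

Lemma spin_connE (R : realType) (M : closed_surface R)
    (h : riem_metric M) (S : spin_structure h) (psi : spinor S)
    (a : sidx S) (i : cidx M) (p : M) (v : 'rV[R]_2) :
  spin_conn psi a i p v = spinor_derive psi a i p v +
    spin_form (fun be ga => hdot h i p (levi_civita h i p v (frame a be))
                                       (frame a ga i p)) *m psi a p.
Proof.
rewrite /spin_conn /spin_form -scalemxAl mulmx_suml; congr (_ + _ *: _).
apply: eq_bigr => be _; rewrite mulmx_suml; apply: eq_bigr => ga _.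
by rewrite -scalemxAl.
Qed.

(** Near [p], Clifford multiplication by a vector of the trivializing frame is a constant matrix, so
    only the spinors are differentiated. *)
Lemma cderive_current (R : realType) (M : closed_surface R)
    (h : riem_metric M) (S : spin_structure h) (psi phi : spinor S)
    (a : sidx S) (i : cidx M) (p : M) (v : 'rV[R]_2) (al : 'I_2) :
  sdom a p -> cdom i p ->
  cderive (fun x => current psi phi a i (param i x) (frame a al i (param i x)))
    (coord i p) v =
  herm (spinor_derive psi a i p v) (gam R al *m phi a p) +
  herm (psi a p) (gam R al *m spinor_derive phi a i p v).
Proof.
move=> ap ip; rewrite (near_eq_cderive (g := fun x =>
    herm (psi a (param i x)) (gam R al *m phi a (param i x)))); last first.
  near=> x; have [ax ix] : sdom a (param i x) /\ cdom i (param i x).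
    by near: x; apply: near_chart => //; exact: sdom_open.
  by rewrite /current cliff_frame.
rewrite (cderive_val (is_cderive_herm (gam R al)
  (fun k => spinor_is_cderive psi v k ap ip)
  (fun k => spinor_is_cderive phi v k ap ip))).
by rewrite coordK.
Unshelve. all: by end_near. Qed.

(* The commutators of the Clifford multiplications with the spin connection forms
   cancel against the terms J(nabla_e e). *)
Lemma div_current_dirac (R : realType) (M : closed_surface R)
    (h : riem_metric M) (S : spin_structure h) (psi phi : spinor S)
    (a : sidx S) (i : cidx M) (p : M) :
  sdom a p -> cdom i p ->
  div_current psi phi a i p =
  herm (psi a p) (dirac phi a i p) - herm (dirac psi a i p) (phi a p).
Proof.
move=> ap ip.
have diracE (eta : spinor S) : dirac eta a i p =
    \sum_(al < 2) gam R al *m spin_conn eta a i p (frame a al i p).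
  by apply: eq_bigr => al _; rewrite cliff_frame.
have herm_sumr u (F : 'I_2 -> 'cV[R[i]]_2) :
    herm u (\sum_(al < 2) F al) = \sum_(al < 2) herm u (F al).
  by rewrite !big_ord_recl !big_ord0 !addr0 hermDr.
have herm_suml u (F : 'I_2 -> 'cV[R[i]]_2) :
    herm (\sum_(al < 2) F al) u = \sum_(al < 2) herm (F al) u.
  by rewrite !big_ord_recl !big_ord0 !addr0 hermDl.
rewrite !diracE herm_sumr herm_suml -sumrB; apply: eq_bigr => al _ /=.
have sw := levi_civita_frame_skew (frame a al i p) _ _ ap ip.
(* The identity holds for each [al] separately. The flat derivatives match on both sides; the
   connection forms leave the commutator of [gam R al] with [spin_form], which gives the term with
   [levi_civita]. *)
rewrite cderive_current // -herm_gam_skew !spin_connE mulmxDr hermDr hermDl.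
rewrite (herm_spin_form _ _ sw) !mulmxA (gam_spin_form _ sw).
rewrite mulmxBl hermDr hermNr /current /cliff.
ring.
Qed.

Theorem lemma3p17 (R : realType) (M : closed_surface R) (h : riem_metric M)
    (S : spin_structure h) (q : nat) (lambda kappa : R)
    (psi : 'I_q -> spinor S)
    (Hpsi : dirac_equation lambda kappa psi) :
  forall (j m : 'I_q) (a : sidx S) (i : cidx M) (p : M),
    sdom a p -> cdom i p ->
    div_current (psi j) (psi m) a i p = 0.
Proof.
move=> j m a i p ap ip; rewrite div_current_dirac // !Hpsi //.
(* The common factor leaves the second argument of [herm] conjugated, hence unchanged since it is
   real. *)
rewrite -!scalerDl hermZl hermZr rmorphD rmorphM /= !conj_real sqnorm_conj.
exact: subrr.
Qed.
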